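(* Let $q$ be a prime power, $F=\mathbb{F}_{q^2}$, and let $G$ be an abelian group of odd order $n$ with $\gcd(n,q)=1$. Fix $\gamma\in F$ with $\frac1n+\gamma^{q+1}=0$. An ideal code $C$ of $F[G^*]$ whose extended code $\widetilde{C}$ is Hermitian self-dual exists if and only if for every prime $r$ dividing $n$, either $ord_r(q)$ is odd or $ord_r(q^2)$ is even.
   Context: $ord_r(a)$ denotes the smallest positive integer $t$ with $a^t\equiv 1\pmod r$. $G$ has exponent $m$; $K$ is the smallest extension of $F=\mathbb{F}_{q^2}$ containing all $m$-th roots of unity, and $G^*$ is the group of all characters (homomorphisms) $\psi:G\to K^\times$. $F[G^*]$ is the group algebra of $G^*$ over $F$; for $f=\sum_{\psi}a_\psi\psi\in F[G^*]$ and $x\in G$ put $f(x)=\sum_\psi a_\psi\psi(x)$, so that $f(0)=\sum_\psi a_\psi\in F$, where $0$ is the identity of the additively written group $G$. An ideal code is an ideal of $F[G^*]$. Its extended code (extension) is $\widetilde{C}=\{(f,-\gamma f(0)): f\in C\}\subseteq F[G^*]\times F$. The Hermitian inner product of $(\sum a_\psi\psi,\,a)$ and $(\sum b_\psi\psi,\,b)$ in $F[G^*]\times F$ is $\sum_\psi a_\psi b_\psi^q+ab^q$, and a code is Hermitian self-dual if it equals its dual with respect to this product. *)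

(* Defs.v *)
From HB Require Import structures.
From mathcomp Require Import all_boot all_order all_algebra all_fingroup.
From mathcomp Require Import all_solvable all_field.

Set Implicit Arguments.
Unset Strict Implicit.
Unset Printing Implicit Defensive.

Import GRing.Theory.
Local Open Scope ring_scope.

(* For a coprime to r > 0 the searched exponent exists and is at most           *)
(* totient r <= r (see mult_ordP); otherwise the value is meaningless.          *)
Definition mult_ord (r a : nat) : nat :=
  (find (fun t => (a ^ t == 1 %[mod r])%N) (iota 1 r)).+1.

Lemma mult_ordP (r a : nat) : (0 < r)%N -> coprime a r ->
  [/\ (0 < mult_ord r a)%N, (a ^ mult_ord r a = 1 %[mod r])%N &
      forall t, (0 < t)%N -> (a ^ t = 1 %[mod r])%N -> (mult_ord r a <= t)%N].
Proof.
move=> r_gt0 co_ar; rewrite /mult_ord.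
set P := fun t => _.
have hasP : has P (iota 1 r).
  apply/hasP; exists (totient r); last by rewrite /P Euler_exp_totient.
  by rewrite mem_iota totient_gt0 r_gt0 add1n ltnS totient_count_coprime
     -[leqRHS]card_ord -sum1_card big_mkord leq_sum // => i _; case: coprime.
have lt_find := hasP; rewrite has_find size_iota in lt_find.
split=> //.
  by move: (nth_find 0%N hasP); rewrite nth_iota // add1n => /eqP.
move=> [//|t] _ at1; rewrite ltnS leqNgt; apply/negP=> lt_t.
have := before_find 0%N lt_t; rewrite nth_iota ?(ltn_trans lt_t) // add1n /P.
by rewrite at1 eqxx.
Qed.

Section GroupAlgebra.

Variables (R : nzRingType) (A : finGroupType).

(* A copy of {ffun A -> R^o}, whose library ring structure is pointwise; here   *)
(* the product is the convolution. R^o is R as a left module over itself.       *)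
Definition group_algebra : Type := {ffun A -> R^o}.

HB.instance Definition _ := GRing.Lmodule.on group_algebra.

Implicit Types f g h : group_algebra.

Definition galg_one : group_algebra := [ffun a => (a == 1%g)%:R].

Definition galg_mul f g : group_algebra :=
  [ffun a => \sum_(b : A) f b * g (b^-1 * a)%g].

Lemma galg_mulA : associative galg_mul.
Proof.
move=> f g h; apply/ffunP=> a; rewrite !ffunE.
under eq_bigr => b _ do rewrite ffunE mulr_sumr.
under [RHS]eq_bigr => c _ do rewrite ffunE mulr_suml.
rewrite [RHS]exchange_big /=; apply: eq_bigr => b _.
rewrite [RHS](reindex_inj (mulgI b)) /=; apply: eq_bigr => c _.
by rewrite mulKg invMg mulrA mulgA.
Qed.

Lemma galg_mul1 : left_id galg_one galg_mul.
Proof.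
move=> f; apply/ffunP=> a; rewrite ffunE (bigD1 1%g) //= big1 => [|b /negPf nb].
  by rewrite ffunE eqxx mul1r invg1 mul1g addr0.
by rewrite ffunE nb mul0r.
Qed.

Lemma galg_mulr1 : right_id galg_one galg_mul.
Proof.
move=> f; apply/ffunP=> a; rewrite ffunE (bigD1 a) //= big1 => [|b nb].
  by rewrite ffunE mulVg eqxx mulr1 addr0.
by rewrite ffunE -eq_invg_mul invgK (negPf nb) mulr0.
Qed.

Lemma galg_mulDl : left_distributive galg_mul +%R.
Proof.
move=> f g h; apply/ffunP=> a; rewrite !ffunE -big_split.
by apply: eq_bigr => b _; rewrite ffunE mulrDl.
Qed.

Lemma galg_mulDr : right_distributive galg_mul +%R.
Proof.
move=> f g h; apply/ffunP=> a; rewrite !ffunE -big_split.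
by apply: eq_bigr => b _; rewrite ffunE mulrDr.
Qed.

Lemma galg_one_neq0 : galg_one != 0.
Proof.
apply/eqP=> /ffunP/(_ 1%g); rewrite !ffunE eqxx.
by apply/eqP; rewrite oner_eq0.
Qed.

HB.instance Definition _ := GRing.Zmodule_isNzRing.Build group_algebra
  galg_mulA galg_mul1 galg_mulr1 galg_mulDl galg_mulDr galg_one_neq0.

Lemma galg_scaleAl (c : R) f g : c *: (f * g) = (c *: f) * g.
Proof.
apply/ffunP=> a; rewrite !ffunE /= scaler_sumr; apply: eq_bigr => b _.
by rewrite ffunE scalerAl.
Qed.

HB.instance Definition _ :=
  GRing.Lmodule_isLalgebra.Build R group_algebra galg_scaleAl.

End GroupAlgebra.

HB.instance Definition _ (R : finNzRingType) (A : finGroupType) :=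
  Finite.copy (group_algebra R A) {ffun A -> R}.

Section Characters.

Variables (G : finZmodType) (K : finFieldType).

Definition is_char (psi : {ffun G -> {unit K}}) : bool :=
  [forall x, forall y, psi (x + y) == (psi x * psi y)%g].

Record char_group : predArgType :=
  Char { char_fun :> {ffun G -> {unit K}}; char_funP : is_char char_fun }.

HB.instance Definition _ := [isSub for char_fun].
HB.instance Definition _ := [Finite of char_group by <:].

Lemma charM (psi : char_group) x y : psi (x + y) = (psi x * psi y)%g.
Proof. by case: psi => f /= /forallP/(_ x)/forallP/(_ y)/eqP. Qed.

Lemma char_one_subproof : is_char [ffun => 1%g].
Proof. by apply/forallP=> x; apply/forallP=> y; rewrite !ffunE mulg1. Qed.

Lemma char_mul_subproof (psi chi : char_group) :
  is_char [ffun x => (psi x * chi x)%g].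
Proof.
apply/forallP=> x; apply/forallP=> y; rewrite !ffunE !charM; apply/eqP/val_inj.
by rewrite /= mulrACA.
Qed.

Lemma char_inv_subproof (psi : char_group) : is_char [ffun x => (psi x)^-1%g].
Proof.
apply/forallP=> x; apply/forallP=> y; rewrite !ffunE charM invMg.
by apply/eqP/val_inj; rewrite /= mulrC.
Qed.

Definition char_one := Char char_one_subproof.
Definition char_mul psi chi := Char (char_mul_subproof psi chi).
Definition char_inv psi := Char (char_inv_subproof psi).

Lemma char_mulA : associative char_mul.
Proof.
by move=> f g h; apply/val_inj/ffunP=> x; rewrite /= !ffunE mulgA.
Qed.

Lemma char_mul1 : left_id char_one char_mul.
Proof. by move=> f; apply/val_inj/ffunP=> x; rewrite /= !ffunE mul1g. Qed.

Lemma char_mulV : left_inverse char_one char_inv char_mul.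
Proof. by move=> f; apply/val_inj/ffunP=> x; rewrite /= !ffunE mulVg. Qed.

HB.instance Definition _ :=
  Finite_isGroup.Build char_group char_mulA char_mul1 char_mulV.

End Characters.

(* finvect_type K is K itself, with the finite field structure it inherits from *)
(* being a finite extension of the finite field F.                              *)
Notation dual_group G K := (char_group G (finvect_type K)).

(* Smallest extension of F containing all m-th roots of unity. *)
Definition root_of_unity_field (F : finFieldType) (m : nat)
    (K : fieldExtType F) : Prop :=
  splittingFieldFor 1%VS ('X^m - 1 : {poly K}) {:K}%VS.

Section IdealCodes.

Variables (F : finFieldType) (G : finZmodType) (K : fieldExtType F).

Local Notation FG := (group_algebra F (dual_group G K)).

Definition galg_eval (f : FG) (x : G) : K :=
  \sum_(psi : dual_group G K) f psi *: (val (psi x) : K).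

Definition galg_eval0 (f : FG) : F := \sum_(psi : dual_group G K) f psi.

Lemma galg_eval0E (f : FG) : galg_eval f 0 = (galg_eval0 f)%:A.
Proof.
rewrite /galg_eval scaler_suml; apply: eq_bigr => psi _; congr (_ *: _).
have /(congr1 val) : psi 0 = 1%g :> {unit finvect_type K}.
  by apply/(mulgI (psi 0)); rewrite -charM addr0 mulg1.
by [].
Qed.

(* Not necessarily proper, unlike ring_quotient's idealr_closed: for trivial G  *)
(* the code sought is the whole algebra.                                        *)
Definition ideal_code (C : {set FG}) : Prop :=
  [/\ 0 \in C,
      {in C &, forall f g, f + g \in C} &
      forall h, {in C, forall f, h * f \in C /\ f * h \in C}].

Definition extended_code (gamma : F) (C : {set FG}) : {set FG * F} :=
  [set (f, - (gamma * galg_eval0 f)) | f in C].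

Definition herm_prod (q : nat) (u v : FG * F) : F :=
  \sum_(psi : dual_group G K) u.1 psi * v.1 psi ^+ q + u.2 * v.2 ^+ q.

Definition herm_dual (q : nat) (D : {set FG * F}) : {set FG * F} :=
  [set u | [forall v in D, herm_prod q u v == 0]].

Definition herm_self_dual (q : nat) (D : {set FG * F}) : Prop :=
  D = herm_dual q D.

End IdealCodes.

(* Main.v *)
Require Import Defs.
From HB Require Import structures.
From mathcomp Require Import all_boot all_order all_algebra all_fingroup.
From mathcomp Require Import all_solvable all_field.
From mathcomp Require Import character classfun.

Set Implicit Arguments.
Unset Strict Implicit.
Unset Printing Implicit Defensive.

Import GRing.Theory.
Local Open Scope ring_scope.

(** Write [n = #|G|], [f^ x] for [galg_eval f x] and [sigma x = - (q x)].

    The map [f |-> f^] is a Fourier transform: it is multiplicative, satisfies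
    [f^ (q^2 x) = f^ x ^+ (q^2)] ([ev_frobenius]), has in its image the indicator
    of every set stable under multiplication by [q^2] ([indicator_exists]), and
    obeys a Parseval identity
    [n * \sum_psi f psi * g psi ^+ q = \sum_z f^ (sigma z) * g^ z ^+ q]
    ([parseval]).  In the extended product the coordinate at infinity
    contributes [gamma ^+ (q + 1) * f(0) * g(0) ^+ q], which by the choice of
    [gamma] cancels exactly the term [z = 0] of this sum ([ext_parseval]).

    Call a set [T] of nonzero points a splitting if [sigma] maps it onto its
    complement among the nonzero points.  By the above, the nonzero common zeros
    of an ideal code with a Hermitian self-dual extension form a splitting
    ([splitting_of_self_dual]), and conversely the ideal of all [f] whose
    transform vanishes on a given splitting has such an extension
    ([self_dual_of_splitting]).

    A splitting must alternate along the cycles of [sigma] on the nonzero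
    points, so it exists iff all these cycles are even.  As [sigma] squared is
    multiplication by [q^2], this says that [- q x = q^(2k) x] has no solution
    [x != 0] ([splitting_existsP]).  Looking at points of prime order, this
    amounts to: no odd power of [q] is [-1] modulo a prime divisor [r] of [n].
    Finally an odd power of [q] is [-1] modulo [r] iff the order of [q] is even
    and the order of [q^2], then half of it, is odd ([mult_ord_condP]).

    The transform needs enough characters with values in [K].  These are
    obtained from the complex irreducible characters of [G] by replacing a
    primitive root of unity of order the exponent of [G] by one of [K]
    ([prim_root_char_separates]). *)

(** * Separation of points by characters *)

(** The linear characters of [G] over the algebraic numbers separate points, as
    their kernels intersect trivially.  Their values are powers of a primitive
    root of unity [w], and sending [w ^+ k] to [z ^+ k] is a well defined
    homomorphism because both roots have the same order. *)
Lemma prim_root_char_separates (G : finZmodType) (L : finFieldType) (z : L) :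
    (exponent [set: G]).-primitive_root z ->
  forall x : G, x != 0 -> exists psi : char_group G L, psi x != 1%g.
Proof.
set m := exponent _ => prim_z x x_neq0.
have m_gt0 : (0 < m)%N by rewrite exponent_gt0.
have [w prim_w] := C_prim_root_exists m_gt0.
have lin i : 'chi[[set: G]]_i \is a linear_char.
  by apply/char_abelianP: i; apply/centsP=> a _ b _; apply: addrC.
have [i xNi] : exists i, x \notin cfker 'chi[[set: G]]_i.
  apply/existsP; rewrite -negb_forall; apply: contra x_neq0 => /forallP kerx.
  have: x \in \bigcap_i cfker 'chi[[set: G]]_i by apply/bigcapP.
  by rewrite TI_cfker_irr => /set1P ->.
have /fin_all_exists[k kE] (y : G) : exists k : 'I_m, 'chi_i y = w ^+ k.
  have [|k ->] := prim_rootP prim_w (x := 'chi_i y); last by exists k.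
  by rewrite -(lin_charX (lin i)) ?inE // expg_exponent ?inE // lin_char1.
have zU y : z ^+ k y \is a GRing.unit.
  rewrite unitrX //; apply/unitrPr; exists (z ^+ m.-1).
  by rewrite -exprS prednK // prim_expr_order.
have psiP : is_char [ffun y => FinRing.Unit (zU y)].
  apply/forallP=> a; apply/forallP=> b; rewrite !ffunE; apply/eqP/val_inj => /=.
  apply/eqP; rewrite -exprD (eq_prim_root_expr prim_z).
  rewrite -(eq_prim_root_expr prim_w) exprD -!kE.
  by rewrite -(lin_charM (lin i)) ?inE.
exists (Char psiP); rewrite /= ffunE; apply: contra xNi => /eqP/(congr1 val)/= zx.
rewrite cfkerEirr inE lin_char1 // kE -(expr0 w) (eq_prim_root_expr prim_w).
by rewrite -(eq_prim_root_expr prim_z) zx expr0.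
Qed.

Lemma root_of_unity_field_prim (F : finFieldType) (K : fieldExtType F)
    (m : nat) :
    (0 < m)%N -> m%:R != 0 :> F -> root_of_unity_field m K ->
  exists z : K, m.-primitive_root z.
Proof.
move=> m_gt0 m_neq0 [rs rsE _].
have sepX : separable_poly ('X^m - 1 : {poly K}).
  by rewrite separable_Xn_sub_1 // -scaler_nat scaler_eq0 oner_eq0 orbF.
suffices /hasP[z _ prim_z] : has m.-primitive_root rs by exists z.
apply: has_prim_root => //.
- apply/allP=> z z_rs; rewrite unity_rootE -subr_eq0.
  have: root ('X^m - 1) z by rewrite (eqp_root rsE) root_prod_XsubC.
  by rewrite /root !hornerE.
- by rewrite -separable_prod_XsubC -(eqp_separable rsE).
have := eqp_size rsE; rewrite size_prod_XsubC size_XnsubC // => -[->].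
exact: leqnn.
Qed.

(** * The Frobenius twist and its splittings *)

Section Splittings.

Variables (G : finZmodType) (q : nat).

(** Conjugating characters and raising to the power [q] turns the value of a
    transform at [x] into its value at [- (q x)], so this is the map through
    which the Hermitian product acts on points. *)
Definition twist (x : G) : G := - (x *+ q).

Definition splitting (T : {set G}) : Prop :=
  0 \notin T /\ forall x, x != 0 -> (twist x \in T) = (x \notin T).

Hypothesis coGq : coprime #|G| q.

Lemma order_dvd_mulrn (x : G) (k : nat) : (#[x]%g %| k)%N = (x *+ k == 0).
Proof. by rewrite order_dvdn FinRing.zmodXgE. Qed.

Lemma mulrn_coprime_inj (k : nat) :
  coprime #|G| k -> injective (fun x : G => x *+ k).
Proof.
move=> co x y /= xy; apply/eqP; rewrite -subr_eq0 -(mulr1n (x - y)).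
rewrite -order_dvd_mulrn -(eqP co) dvdn_gcd [X in _ && X]order_dvd_mulrn.
rewrite mulrnBl xy subrr eqxx andbT.
by rewrite -cardsT order_dvdG ?inE.
Qed.

Lemma twistK2 x : twist (twist x) = x *+ q ^ 2.
Proof. by rewrite /twist mulNrn opprK -mulrnA mulnn. Qed.

Lemma twist0 : twist 0 = 0.
Proof. by rewrite /twist mul0rn oppr0. Qed.

Lemma twist_inj : injective twist.
Proof. by move=> x y /oppr_inj; apply: (mulrn_coprime_inj coGq). Qed.

Lemma twist_eq0 x : (twist x == 0) = (x == 0).
Proof. by rewrite -{1}twist0 (inj_eq twist_inj). Qed.

Lemma iter_twist2 k x : iter k (fun y : G => y *+ q ^ 2) x = x *+ q ^ k.*2.
Proof.
elim: k => [|k IH] /=; first by rewrite expn0.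
by rewrite IH -mulrnA -expnD addn2 doubleS.
Qed.

(** A splitting alternates along each cycle of the twist, so it exists iff no
    nonzero cycle is odd.  A cycle is odd iff the image of one of its points is
    also reached from that point by an even number of steps. *)
Lemma splitting_existsP :
  (exists T, splitting T) <->
  (forall (x : G) (k : nat), x != 0 -> twist x != x *+ q ^ k.*2).
Proof.
split=> [[T [_ splT]] x k x0 | no_cycle].
  have stab y j : y != 0 -> (y *+ q ^ j.*2 \in T) = (y \in T).
    move=> y0; rewrite -iter_twist2; elim: j => //= j <-.
    rewrite -twistK2; set z := iter _ _ _.
    have z0 : z != 0.
      rewrite /z; elim: (j) => //= i; by rewrite -twistK2 !twist_eq0.
    by rewrite splT ?twist_eq0 // splT // negbK.
  apply/eqP=> tx; have := splT x x0; rewrite tx stab //; by case: (x \in T).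
pose s2 (x : G) := x *+ q ^ 2.
have s2_inj : injective s2.
  by move=> x y; rewrite /s2 -!twistK2 => /twist_inj/twist_inj.
(* On each cycle, choose the points at even distance from a base point. *)
exists [set x | (x != 0) && fconnect s2 (froot twist x) x].
split=> [|x x0]; first by rewrite inE eqxx.
have rootE : froot twist (twist x) = froot twist x.
  apply/eqP; rewrite (root_connect (fconnect_sym twist_inj)).
  by rewrite (fconnect_sym twist_inj) fconnect1.
rewrite !inE twist_eq0 x0 rootE /=; set z := froot _ _.
have conn_even k : fconnect s2 z (iter k.*2 twist z).
  have -> : iter k.*2 twist z = iter k s2 z.
    by elim: k => //= k <-; rewrite /s2 -twistK2.
  exact: fconnect_iter.
have [zx|zNx] := boolP (fconnect s2 z x).
  apply/negP => ztx; have := connect_trans _ ztx (x := x).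
  rewrite (fconnect_sym s2_inj) => /(_ zx)/iter_findex/eqP.
  by rewrite iter_twist2 eq_sym (negPf (no_cycle _ _ x0)).
have zx : fconnect twist z x by rewrite (fconnect_sym twist_inj) connect_root.
have xE := iter_findex zx; move: (findex _ _ _) xE => k xE.
have := odd_double_half k; case: (odd k) => kE.
  by rewrite -xE -iterS -kE add1n -doubleS; apply: conn_even.
by case/negP: zNx; rewrite -xE -kE add0n; apply: conn_even.
Qed.

End Splittings.

(** * Arithmetic of the orders *)

Lemma mult_ord_dvd (r a t : nat) : (0 < r)%N -> coprime a r ->
  (a ^ t = 1 %[mod r])%N -> (mult_ord r a %| t)%N.
Proof.
move=> r0 co at1; have [o0 o1 omin] := mult_ordP r0 co.
rewrite /dvdn; set o := mult_ord r a in o0 o1 omin *.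
apply/eqP; case E: (t %% o)%N => [//|s].
have := omin (t %% o)%N; rewrite {1}E => /(_ isT); rewrite leqNgt ltn_mod o0.
move=> H; suff: false by []. apply: H.
rewrite -at1 [in RHS](divn_eq t o) expnD (mulnC _ o) expnM.
by rewrite -[in RHS]modnMml -[in RHS]modnXm o1 modnXm exp1n modnMml mul1n.
Qed.

(** If [q ^ j = -1] modulo [r] with [j] odd, then [q ^ (2 * j) = 1], so the order
    of [q ^ 2] divides [j] and is odd; were the order of [q] odd as well, it
    would divide [j], giving [1 = -1].  Conversely, if the order of [q] is even
    and the order [t] of [q ^ 2] is odd, then [q ^ t] is a square root of [1]
    other than [1]. *)
Lemma mult_ord_condP (r q : nat) : prime r -> odd r -> coprime q r ->
  (odd (mult_ord r q) \/ ~~ odd (mult_ord r (q ^ 2)%N)) <->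
  (forall k, ~~ (r %| q ^ k.*2.+1 + 1)%N).
Proof.
move=> pr oddr co; have r0 := prime_gt0 pr.
have q0 : (0 < q)%N.
  case: (posnP q) co => // ->; rewrite /coprime gcd0n => /eqP r1.
  by rewrite r1 in pr.
have r_gt2 : (2 < r)%N by rewrite odd_prime_gt2.
have co2 : coprime (q ^ 2) r by rewrite coprimeXl.
have [s0 s1 _] := mult_ordP r0 co; have [t0 t1 _] := mult_ordP r0 co2.
have sd := mult_ord_dvd r0 co; have td := mult_ord_dvd r0 co2.
set s := mult_ord r q in s0 s1 sd *; set t := mult_ord r (q ^ 2) in t0 t1 td *.
have dvd_sub1 j : (r %| q ^ j - 1)%N = (q ^ j == 1 %[mod r])%N.
  by rewrite eqn_mod_dvd ?expn_gt0 ?q0.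
have dvd_double j :
  (r %| q ^ (2 * j) - 1)%N = (r %| q ^ j - 1)%N || (r %| q ^ j + 1)%N.
  by rewrite mulnC expnM -[X in (_ - X)%N](exp1n 2) subn_sqr Euclid_dvdM.
split=> [H k | H].
  apply/negP=> rk; set j := k.*2.+1 in rk.
  have oddj : odd j by rewrite /= odd_double.
  have r2j : (q ^ (2 * j) = 1 %[mod r])%N.
    by apply/eqP; rewrite -dvd_sub1 dvd_double rk orbT.
  have rNj : ~~ (r %| q ^ j - 1)%N.
    apply/negP=> rj; have := dvdn_sub rk rj.
    rewrite subnBA ?expn_gt0 ?q0 // -addnA addKn.
    rewrite -[(1 + 1)%N]/2%N => /(dvdn_leq (isT : 0 < 2)%N)/(leq_trans r_gt2).
    by rewrite ltnn.
  case: H => [odds|/negP]; last first.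
    by apply; apply: dvdn_odd (td _ _) oddj; rewrite -expnM.
  case/negP: rNj; rewrite dvd_sub1; have /dvdnP[c ->] : (s %| j)%N.
    by rewrite -(Gauss_dvdr (m := s) (n := 2)) ?sd // coprimen2.
  by rewrite mulnC expnM -modnXm s1 modnXm exp1n.
have [|evens] := boolP (odd s); first by left.
have [oddt|] := boolP (odd t); last by right.
have: (r %| q ^ (2 * t) - 1)%N by rewrite dvd_sub1 expnM t1.
have := H t./2; rewrite dvd_double -[_.*2.+1]/(true + t./2.*2)%N -oddt.
rewrite odd_double_half.
move=> /negPf ->; rewrite orbF dvd_sub1 => /eqP/sd st.
by rewrite (dvdn_odd st oddt) in evens.
Qed.

(** * Splittings and the orders of $q$ *)

(** A nonzero point [x] lies on an odd cycle iff its order divides some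
    [q ^ k.*2 + q].  The order may be replaced by any of its prime divisors, and
    the factor [q] is removed by coprimality. *)
Lemma splitting_exists_ordP (G : finZmodType) (q : nat) :
    odd #|G| -> coprime #|G| q ->
  (exists T : {set G}, splitting q T) <->
  (forall r : nat, prime r -> (r %| #|G|)%N ->
      odd (mult_ord r q) \/ ~~ odd (mult_ord r (q ^ 2)%N)).
Proof.
move=> oddG coGq; apply: (iff_trans (splitting_existsP coGq)).
have rP r : prime r -> (r %| #|G|)%N -> odd r /\ coprime q r.
  by move=> pr rG; rewrite (dvdn_odd rG oddG) coprime_sym (coprime_dvdl rG coGq).
have twistE (x : G) k :
    (twist q x == x *+ q ^ k.*2) = (x *+ (q ^ k.*2 + q) == 0).
  by rewrite /twist mulrnDr eq_sym -subr_eq0 opprK.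
have qE k : (q ^ k.+1.*2 + q = (q ^ k.*2.+1 + 1) * q)%N.
  by rewrite doubleS mulnDl mul1n -expnSr.
split=> [no_cycle r pr rG | ordr x k x0].
  have [oddr co] := rP r pr rG; apply/mult_ord_condP => // k; apply/negP=> rk.
  have [|x _ xr] := Cauchy (G := [set: G]%G) pr; first by rewrite /= cardsT.
  have x0 : x != 0.
    by rewrite -(mulr1n x) -order_dvd_mulrn xr dvdn1 neq_ltn prime_gt1 ?orbT.
  have := no_cycle x k.+1 x0; rewrite twistE -order_dvd_mulrn xr qE.
  by rewrite dvdn_mulr.
rewrite twistE -order_dvd_mulrn; apply/negP=> xk.
have x_neq1 : #[x]%g != 1%N by rewrite -dvdn1 order_dvd_mulrn.
have pr : prime (pdiv #[x]%g).
  by rewrite pdiv_prime // ltn_neqAle eq_sym x_neq1 order_gt0.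
have rG : (pdiv #[x]%g %| #|G|)%N.
  by rewrite (dvdn_trans (pdiv_dvd _)) // -cardsT order_dvdG ?inE.
have := dvdn_trans (pdiv_dvd _) xk.
have := ordr _ pr rG; set r := pdiv _ in pr rG *; have [oddr co] := rP r pr rG.
move/(mult_ord_condP pr oddr co); case: k {xk} => [|k] H.
  (* Here [q ^ 0 + q] is already the odd power [q ^ 1] plus one. *)
  by apply/negP; have := H 0%N; rewrite expn1 addnC.
by rewrite qE Gauss_dvdl ?(negPf (H k)) // coprime_sym.
Qed.

(** * Fourier transform on the group algebra of the characters *)

Section HermitianCodes.

Variables (F : finFieldType) (G : finZmodType) (K : fieldExtType F) (q : nat).

Local Notation A := (dual_group G K).
Local Notation FG := (group_algebra F A).
Local Notation sigma := (twist q).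

Hypothesis cardF : #|F| = (q ^ 2)%N.
Hypothesis qchar : [pchar F].-nat q.
Hypothesis coGq : coprime #|G| q.
Hypothesis n_neq0 : #|G|%:R != 0 :> F.
Hypothesis separated : forall x : G, x != 0 -> exists psi : A, psi x != 1%g.

Implicit Types (psi phi : A) (f g h : FG) (x y z : G).

Definition chi psi x : K := val (psi x).

Lemma chiD psi x y : chi psi (x + y) = chi psi x * chi psi y.
Proof. by rewrite /chi Defs.charM. Qed.

Lemma chi_neq0 psi x : chi psi x != 0.
Proof. by have := valP (psi x); rewrite unitfE. Qed.

Lemma chi0 psi : chi psi 0 = 1.
Proof.
by apply: (mulfI (chi_neq0 psi 0)); rewrite -chiD addr0 mulr1.
Qed.

Lemma chiX psi x k : chi psi (x *+ k) = chi psi x ^+ k.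
Proof. by elim: k => [|k IH]; rewrite ?chi0 // mulrS exprS chiD IH. Qed.

Lemma chiN psi x : chi psi (- x) = (chi psi x)^-1.
Proof.
by apply: (mulfI (chi_neq0 psi x)); rewrite -chiD subrr chi0 mulfV ?chi_neq0.
Qed.

Lemma chi1 x : chi 1%g x = 1.
Proof. by rewrite /chi ffunE. Qed.

Lemma chiM psi phi x : chi (psi * phi)%g x = chi psi x * chi phi x.
Proof. by rewrite /chi ffunE. Qed.

Lemma chiV psi x : chi psi^-1%g x = (chi psi x)^-1.
Proof.
by apply: (mulfI (chi_neq0 psi x)); rewrite -chiM mulgV chi1 mulfV ?chi_neq0.
Qed.

Lemma sum_chi_points psi :
  \sum_x chi psi x = if psi == 1%g then #|G|%:R else 0.
Proof.
case: eqP => [->|psi_neq1].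
  by under eq_bigr do rewrite chi1; rewrite sumr_const.
have [y ychi] : exists y, chi psi y != 1.
  apply/existsP; rewrite -negb_forall; apply/negP=> /forallP all1.
  case: psi_neq1; apply/val_inj/ffunP=> y; apply/val_inj/eqP.
  by rewrite ffunE; apply: all1.
apply/eqP; have: (chi psi y - 1) * (\sum_x chi psi x) == 0.
  rewrite mulrBl mul1r mulr_sumr subr_eq0; apply/eqP.
  by under eq_bigr do rewrite -chiD; rewrite [RHS](reindex_inj (addrI y)).
by rewrite mulf_eq0 subr_eq0 (negPf ychi).
Qed.

Lemma sum_chi_chars0 x :
  \sum_psi chi psi x = if x == 0 then #|A|%:R else 0.
Proof.
case: eqVneq => [->|/separated[phi phix]].
  by under eq_bigr do rewrite chi0; rewrite sumr_const.
apply/eqP; have: (chi phi x - 1) * (\sum_psi chi psi x) == 0.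
  rewrite mulrBl mul1r mulr_sumr subr_eq0; apply/eqP.
  by under eq_bigr do rewrite -chiM; rewrite [RHS](reindex_inj (mulgI phi)).
rewrite mulf_eq0 subr_eq0; case: eqP => // phi1.
by case/eqP: phix; apply: val_inj.
Qed.

(** Orthogonality of characters involves their number only as an element of
    [K], where it can be found by mere double counting: both sides are the sum of all character
    values, taken in the two orders. *)
Lemma card_chars : #|A|%:R = #|G|%:R :> K.
Proof.
have: \sum_x \sum_psi chi psi x = \sum_psi \sum_x chi psi x.
  by rewrite exchange_big.
under eq_bigr do rewrite sum_chi_chars0.
under [RHS]eq_bigr do rewrite sum_chi_points.
by rewrite -!big_mkcond !big_pred1_eq.
Qed.

Lemma sum_chi_chars x :
  \sum_psi chi psi x = if x == 0 then #|G|%:R else 0.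
Proof. by rewrite sum_chi_chars0 card_chars. Qed.

Local Notation ev := (@galg_eval F G K).

Lemma evE f x : ev f x = \sum_psi f psi *: chi psi x.
Proof. by []. Qed.

Lemma evD f g x : ev (f + g) x = ev f x + ev g x.
Proof.
by rewrite !evE -big_split; apply: eq_bigr => psi _; rewrite ffunE scalerDl.
Qed.

Lemma ev0 x : ev 0 x = 0.
Proof. by rewrite evE big1 // => psi _; rewrite ffunE scale0r. Qed.

Lemma evM f g x : ev (f * g) x = ev f x * ev g x.
Proof.
rewrite !evE mulr_suml.
under eq_bigr do rewrite ffunE scaler_suml.
rewrite exchange_big; apply: eq_bigr => phi _ /=.
rewrite (reindex_inj (mulgI phi)) mulr_sumr; apply: eq_bigr => psi _.
by rewrite mulKg chiM -scalerAr -scalerAl scalerA mulrC.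
Qed.

Lemma pcharK : [pchar K].-nat q.
Proof. by rewrite (eq_pnat _ (pchar_lalg K)). Qed.

Lemma q_gt0 : (0 < q)%N.
Proof. by case/andP: qchar. Qed.

Lemma pchar_sumXn (R : fieldType) (I : finType) (P : pred I) (E : I -> R)
    (k : nat) :
  [pchar R].-nat k -> (\sum_(i | P i) E i) ^+ k = \sum_(i | P i) E i ^+ k.
Proof.
move=> kp; have k0 : (0 < k)%N by case/andP: kp.
apply: (big_morph (fun a : R => a ^+ k)) => [a b|].
  exact: exprDn_pchar.
by rewrite expr0n gtn_eqF.
Qed.

Lemma pchar_q2 : [pchar K].-nat (q ^ 2)%N.
Proof. by rewrite pnatX pcharK. Qed.

Lemma ev_frobenius f x : ev f (x *+ q ^ 2) = ev f x ^+ (q ^ 2).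
Proof.
rewrite !evE pchar_sumXn ?pchar_q2 //; apply: eq_bigr => psi _.
by rewrite exprZn chiX -cardF expf_card.
Qed.

(** The elements of [F] are already all the roots of ['X^#|F| - 'X]. *)
Lemma base_fieldP (z : K) : z ^+ (q ^ 2) = z -> exists a : F, z = a%:A.
Proof.
move=> zq; have: root (map_poly (in_alg K) ('X^#|F| - 'X)) z.
  rewrite rmorphB /= map_polyXn map_polyX /root !hornerE.
  by rewrite cardF zq subrr.
rewrite finField_genPoly rmorph_prod /= /root horner_prod prodf_seq_eq0.
case/hasP=> a _ /=; rewrite rmorphB /= map_polyX map_polyC /= !hornerE subr_eq0.
by move/eqP=> ->; exists a.
Qed.

Lemma alg_inj : injective (fun a : F => a%:A : K).
Proof. exact: (fmorph_inj (in_alg K)). Qed.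

(** The inverse transform of a function on points has coefficients in [K]; for
    the indicator of a set stable under multiplication by [q ^ 2] they are fixed
    by the Frobenius map of [F], hence lie in [F].  These elements are
    the idempotents of the group algebra. *)
Lemma indicator_exists (O : {set G}) :
    (forall x, (x *+ q ^ 2 \in O) = (x \in O)) ->
  exists e : FG, forall x, ev e x = (x \in O)%:R.
Proof.
move=> stabO; pose c psi : K := \sum_(y in O) chi psi (- y).
have cF psi : exists a : F, c psi = a%:A.
  apply: base_fieldP; rewrite /c pchar_sumXn ?pchar_q2 //.
  have inj2 : injective (fun y : G => y *+ q ^ 2).
    by apply: mulrn_coprime_inj; rewrite coprimeXr.
  rewrite [RHS](reindex_inj inj2) /=; under [RHS]eq_bigl do rewrite stabO.
  by apply: eq_bigr => y _; rewrite -chiX mulNrn.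
have [a aE] := fin_all_exists cF.
exists [ffun psi => #|G|%:R^-1 * a psi] => x; rewrite evE.
have -> : \sum_psi ([ffun psi => #|G|%:R^-1 * a psi] : FG) psi *: chi psi x
        = #|G|%:R^-1 *: \sum_(y in O) \sum_psi chi psi (x - y).
  rewrite exchange_big scaler_sumr; apply: eq_bigr => psi _.
  rewrite ffunE -scalerA; congr (_ *: _).
  rewrite -[a psi *: _]mulr_algl -aE /c mulr_suml; apply: eq_bigr => y _.
  by rewrite addrC chiD.
under eq_bigr do rewrite sum_chi_chars subr_eq0.
rewrite -big_mkcondr /=; case: (boolP (x \in O)) => [xO|xNO].
  rewrite (big_pred1 x) => [|y]; last first.
    by rewrite /= eq_sym andbC; case: eqVneq => // ->.
  by rewrite -scaler_nat scalerA mulVf // scale1r.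
rewrite big1 ?scaler0 // => y /andP[yO /eqP xy]; by rewrite xy yO in xNO.
Qed.

(** Expanding the right-hand side, the sum over [z] of
    [psi (sigma z) * phi z ^+ q = (psi^-1 * phi) (q z)] is [n] if [phi = psi]
    and [0] otherwise, since multiplication by [q] permutes [G]. *)
Lemma parseval f g :
  (#|G|%:R * \sum_psi f psi * g psi ^+ q)%:A
  = \sum_z ev f (sigma z) * ev g z ^+ q.
Proof.
have evq z : ev g z ^+ q = \sum_psi g psi ^+ q *: chi psi (z *+ q).
  rewrite evE pchar_sumXn ?pcharK //; apply: eq_bigr => psi _.
  by rewrite exprZn chiX.
under [RHS]eq_bigr => z _.
  rewrite evq evE mulr_suml; under eq_bigr => psi _ do rewrite mulr_sumr.
  over.
rewrite exchange_big mulr_sumr scaler_suml; apply: eq_bigr => psi _ /=.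
rewrite exchange_big (bigD1 psi) //= [X in _ + X]big1 => [|phi phiN].
  under eq_bigr => z _.
    rewrite -scalerAl -scalerAr /twist chiN mulVf ?chi_neq0 // scalerA.
    over.
  by rewrite sumr_const addr0 -[RHS]scaler_nat scalerA.
apply: (etrans
  (y := \sum_z (f psi * g phi ^+ q) *: chi (psi^-1 * phi)%g (z *+ q))).
  apply: eq_bigr => z _.
  by rewrite -scalerAl -scalerAr /twist chiN scalerA chiM chiV.
rewrite -scaler_sumr.
have /= <- := reindex_inj (P := xpredT) (F := chi (psi^-1 * phi)%g)
  (mulrn_coprime_inj coGq).
rewrite sum_chi_points.
by rewrite -eq_mulVg1 eq_sym (negPf phiN) scaler0.
Qed.

(** Orthogonality to a whole ideal is pointwise.  Multiplying [g] by the
    characters gives, through Parseval, the vanishing of all Fourier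
    coefficients of [z |-> f^ (sigma z) * g^ z ^+ q], and the transform is
    injective. *)
Lemma pairing_ideal_eq0 f g :
    (forall h, \sum_psi f psi * (h * g) psi ^+ q = 0) ->
  forall z, ev f (sigma z) * ev g z ^+ q = 0.
Proof.
move=> orth z; pose w y := ev f (sigma y) * ev g y ^+ q.
(* The Fourier coefficients of [w], with [z] reparametrised as [z *+ q]. *)
have hatw psi : \sum_y chi psi (y *+ q) * w y = 0.
  pose h : FG := [ffun phi => (phi == psi)%:R].
  have evh y : ev h y = chi psi y.
    rewrite evE (bigD1 psi) //= big1 => [|phi /negPf phiN].
      by rewrite ffunE eqxx scale1r addr0.
    by rewrite ffunE phiN scale0r.
  have := parseval f (h * g); rewrite orth mulr0 scale0r => /esym hE.
  rewrite -[RHS]hE; apply: eq_bigr => y _.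
  by rewrite evM exprMn evh chiX /w mulrCA.
suff: #|G|%:R *: w z = 0 by move/eqP; rewrite scaler_eq0 (negPf n_neq0) => /eqP.
have: \sum_psi chi psi (- (z *+ q)) * \sum_y chi psi (y *+ q) * w y = 0.
  by rewrite big1 // => psi _; rewrite hatw mulr0.
under eq_bigr do rewrite mulr_sumr.
rewrite exchange_big (bigD1 z) //= [X in _ + X]big1 => [|y yz].
  under eq_bigr do rewrite mulrA -chiD addNr chi0 mul1r.
  by rewrite addr0 sumr_const -[_ *+ _]mulr_natl card_chars mulr_natl scaler_nat.
under eq_bigr do rewrite mulrA -chiD.
rewrite -mulr_suml sum_chi_chars addrC subr_eq0.
by rewrite (inj_eq (mulrn_coprime_inj coGq)) (negPf yz) mul0r.
Qed.

Lemma ev_at0 f : ev f 0 = (galg_eval0 f)%:A.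
Proof. exact: galg_eval0E. Qed.

(** * Ideal codes *)

Variable gamma : F.
Hypothesis gammaE : (#|G|%:R)^-1 + gamma ^+ (q + 1) = 0.

Local Notation ext f := (f, - (gamma * galg_eval0 f)).

Lemma card_gamma : #|G|%:R * gamma ^+ (q + 1) = -1.
Proof.
have/eqP := gammaE; rewrite addrC addr_eq0 => /eqP->.
by rewrite mulrN mulfV.
Qed.

(** The coordinate at infinity cancels the term [z = 0], by [card_gamma]. *)
Lemma ext_parseval f g :
  (#|G|%:R * herm_prod q (ext f) (ext g))%:A
  = \sum_(z | z != 0) ev f (sigma z) * ev g z ^+ q.
Proof.
rewrite /herm_prod /= mulrDr scalerDl parseval (bigD1 0) //= twist0 !ev_at0.
rewrite addrAC -[RHS]add0r; congr (_ + _).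
have -> : #|G|%:R * (- (gamma * galg_eval0 f) * (- (gamma * galg_eval0 g)) ^+ q)
    = - (galg_eval0 f * galg_eval0 g ^+ q).
  rewrite exprNn_pchar // mulrNN exprMn mulrACA -exprS -addn1.
  by rewrite [LHS]mulrA card_gamma mulN1r.
by rewrite exprZn expr1n -scalerAl mul1r scalerA scaleNr subrr.
Qed.


Implicit Types (C : {set FG}) (T : {set G}).

Lemma galg_eval0_eq0 f : (galg_eval0 f == 0) = (ev f 0 == 0).
Proof. by rewrite ev_at0 scaler_eq0 oner_eq0 orbF. Qed.

Lemma herm_prod_eq0 f g :
    (forall z, z != 0 -> ev f (sigma z) * ev g z ^+ q = 0) ->
  herm_prod q (ext f) (ext g) = 0.
Proof.
move=> fg0; apply: (mulfI n_neq0); apply: alg_inj.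
by rewrite ext_parseval mulr0 scale0r big1.
Qed.

(** For [g] vanishing at [0] the coordinate at infinity of every multiple of [g]
    is zero, so duality reduces to the plain pairing with an ideal. *)
Lemma herm_dual_ideal C f (a : F) g :
    ideal_code C -> (f, a) \in herm_dual q (extended_code gamma C) ->
    g \in C -> ev g 0 = 0 ->
  forall z, ev f (sigma z) * ev g z ^+ q = 0.
Proof.
move=> [_ _ Cmul]; rewrite inE => /forall_inP orth gC g0.
apply: pairing_ideal_eq0 => h; have hgC := (Cmul h g gC).1.
have /eqP := orth _ (imset_f (fun c => ext c) hgC).
have /eqP -> : galg_eval0 (h * g) == 0.
  by rewrite galg_eval0_eq0 evM g0 mulr0.
by rewrite /herm_prod /= mulr0 oppr0 expr0n gtn_eqF ?q_gt0 // mulr0 addr0.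
Qed.

(** Take the code of all [f] whose transform vanishes on [T].  Its extension is
    self-orthogonal since at each [z != 0] either [z] or [sigma z] is in [T].
    For the other inclusion, a dual vector is tested against two elements of
    the code: the indicator of the nonzero points outside [T] forces its
    transform to vanish on [T], and the indicator of [0] determines its
    coordinate at infinity. *)
Lemma self_dual_of_splitting T : splitting q T ->
  exists C, ideal_code C /\ herm_self_dual q (extended_code gamma C).
Proof.
move=> [T0 splT]; pose C := [set f : FG | [forall x in T, ev f x == 0]].
have CP f : reflect {in T, forall x, ev f x = 0} (f \in C).
  rewrite inE; apply: (iffP forall_inP) => H x /H; first by move/eqP.
  by move=> ->.
have idC : ideal_code C.
  split=> [|f g /CP fC /CP gC|h f /CP fC].
  - by apply/CP=> x _; rewrite ev0.
  - by apply/CP=> x xT; rewrite evD fC ?gC // addr0.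
  by split; apply/CP=> x xT; rewrite evM fC // ?mul0r ?mulr0.
exists C; split=> //; apply/setP=> -[f a]; apply/imsetP/idP => [[{}f fC [-> ->]]|dual_f].
  rewrite inE; apply/forall_inP=> _ /imsetP[g gC ->]; apply/eqP/herm_prod_eq0 => z z0.
  have [zT|zNT] := boolP (z \in T).
    by rewrite (CP g gC) // expr0n gtn_eqF ?q_gt0 // mulr0.
  by rewrite (CP f fC) ?mul0r // splT.
have fC : f \in C.
  apply/CP=> y yT.
  have [z yE] : exists z, y = sigma z.
    by exists (finv sigma y); rewrite (f_finv (twist_inj coGq)).
  have z0 : z != 0 by apply: contraNneq T0 => z0; rewrite -(twist0 _ q) -z0 -yE.
  have zNT : z \notin T by rewrite -splT // -yE.
  have [x|e eE] := @indicator_exists [set x | (x != 0) && (x \notin T)].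
    rewrite !inE -twistK2 !twist_eq0 //; have [//|x0] := eqVneq x 0.
    by rewrite !splT ?twist_eq0 // negbK.
  have eC : e \in C by apply/CP=> x xT; rewrite eE !inE xT andbF.
  have := herm_dual_ideal idC dual_f eC _ z; rewrite !eE !inE eqxx z0 zNT -yE.
  by rewrite expr1n mulr1; apply.
exists f => //; congr (_, _).
have [x|e eE] := @indicator_exists [set 0].
  by rewrite !inE -twistK2 !twist_eq0.
have eC : e \in C.
  by apply/CP=> x xT; rewrite eE !inE; case: eqP xT T0 => // -> ->.
have e0 : galg_eval0 e = 1.
  by apply: alg_inj; rewrite /= -ev_at0 eE !inE eqxx scale1r.
move: dual_f; rewrite inE => /forall_inP/(_ _ (imset_f (fun c => ext c) eC))/eqP.
rewrite /herm_prod /= e0 mulr1.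
have -> : \sum_psi f psi * e psi ^+ q = #|G|%:R^-1 * galg_eval0 f.
  apply: (mulfI n_neq0); apply: alg_inj; rewrite /= parseval mulVKf // (bigD1 0) //=.
  rewrite twist0 eE !inE eqxx expr1n mulr1 big1 ?addr0 -?ev_at0 // => z /negPf z0.
  by rewrite eE !inE z0 expr0n gtn_eqF ?q_gt0 // mulr0.
rewrite exprNn_pchar // mulrN => /eqP; rewrite subr_eq0 => /eqP fE.
have -> : galg_eval0 f = #|G|%:R * (a * gamma ^+ q) by rewrite -fE mulVKf.
by rewrite mulrCA (mulrCA gamma) -exprS -addn1 [in RHS]mulrCA card_gamma mulrN1 opprK.
Qed.

(** If [x] is not a zero of [C], then some [g] in [C] that vanishes at [0] is
    nonzero at [x], and duality makes every [f] in [C] vanish at [sigma x].  If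
    both [x] and [sigma x] were zeros, then the indicator of all points with
    this property would be orthogonal to [C], hence in [C], although it does
    not vanish at [x]. *)
Lemma splitting_of_self_dual C :
    ideal_code C -> herm_self_dual q (extended_code gamma C) ->
  splitting q [set x | (x != 0) && [forall f in C, ev f x == 0]].
Proof.
move=> idC sdC; set T := [set x | _].
have TP x : x != 0 -> reflect {in C, forall f, ev f x = 0} (x \in T).
  move=> x0; rewrite inE x0; apply: (iffP forall_inP) => H f /H; first by move/eqP.
  by move=> ->.
have T0 : 0 \notin T by rewrite inE eqxx.
have dualC f : f \in C -> ext f \in herm_dual q (extended_code gamma C).
  by move=> fC; rewrite -sdC; apply: imset_f.
split=> // x x0; have sx0 : sigma x != 0 by rewrite twist_eq0.
have [xT|xNT] := boolP (x \in T); last first.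
  move: xNT; rewrite {1}inE x0 negb_forall_in => /exists_inP[g gC gx].
  have [y|h hE] := @indicator_exists [set~ 0].
    by rewrite !inE -twistK2 !twist_eq0.
  have hgC : h * g \in C by case: idC => _ _ /(_ h g gC)[].
  apply/(TP _ sx0) => f fC.
  have := herm_dual_ideal idC (dualC f fC) hgC _ x.
  rewrite !evM !hE !inE eqxx x0 mul0r mul1r => /(_ erefl)/eqP.
  by rewrite mulf_eq0 expf_eq0 (negPf gx) andbF orbF => /eqP.
apply/negbTE/negP=> sxT.
have stabT y : (y *+ q ^ 2 \in T) = (y \in T).
  rewrite !inE -{1}twistK2 !twist_eq0 //; congr (_ && _); apply: eq_forallb => f.
  by rewrite ev_frobenius expf_eq0 expn_gt0 q_gt0.
have stw y : sigma (y *+ q ^ 2) = sigma y *+ q ^ 2 by rewrite -!twistK2.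
pose O := [set y | (y \in T) && (sigma y \in T)].
have xO : x \in O by rewrite inE xT.
have [y|e eE] := @indicator_exists O.
  by rewrite [LHS]inE [RHS]inE stw !stabT.
have : ext e \in extended_code gamma C.
  rewrite sdC inE; apply/forall_inP=> _ /imsetP[g gC ->].
  apply/eqP/herm_prod_eq0 => z z0; rewrite eE inE twistK2 stabT andbC.
  have [zT|] := boolP (z \in T); last by rewrite mul0r.
  by rewrite (TP z z0 zT g gC) expr0n gtn_eqF ?q_gt0 // mulr0.
case/imsetP=> c cC [ec _]; have := TP x x0 xT c cC.
by rewrite -ec eE xO => /eqP; rewrite oner_eq0.
Qed.

End HermitianCodes.

(** * The existence theorem *)

Theorem theorem3p11 (p e q : nat) (hp : prime p) (he : (0 < e)%N)
    (hq : q = (p ^ e)%N)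
    (F : finFieldType) (hF : #|F| = (q ^ 2)%N)
    (G : finZmodType) (hodd : odd #|G|) (hco : coprime #|G| q)
    (K : fieldExtType F) (hK : root_of_unity_field (exponent [set: G]) K)
    (gamma : F) (hgamma : (#|G|%:R)^-1 + gamma ^+ (q + 1) = 0) :
  (exists C : {set group_algebra F (dual_group G K)},
      ideal_code C /\ herm_self_dual q (extended_code gamma C))
  <->
  (forall r : nat, prime r -> (r %| #|G|)%N ->
      odd (mult_ord r q) \/ ~~ odd (mult_ord r (q ^ 2)%N)).

Proof.
have charF : p \in [pchar F].
  by apply: (card_finPcharP (n := e * 2)); rewrite // hF hq expnM.
have qchar : [pchar F].-nat q by rewrite hq pnatX pnatE // charF.
have pNn : ~~ (p %| #|G|)%N.
  by rewrite -prime_coprime // coprime_sym -(coprime_pexpr _ _ he) -hq.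
have n_neq0 : #|G|%:R != 0 :> F by rewrite -(dvdn_pcharf charF).
have m_neq0 : (exponent [set: G])%:R != 0 :> F.
  rewrite -(dvdn_pcharf charF); apply: contra pNn => /dvdn_trans; apply.
  by rewrite -cardsT exponent_dvdn.
have [z prim_z] := root_of_unity_field_prim (exponent_gt0 [set: G]) m_neq0 hK.
have sep := @prim_root_char_separates G (finvect_type K) z prim_z.
apply: iff_trans (splitting_exists_ordP hodd hco); split=> [[C [idC sdC]]|[T splT]].
  by exists [set x | (x != 0) && [forall f in C, galg_eval f x == 0]];
    apply: splitting_of_self_dual sdC.
exact: self_dual_of_splitting splT.
Qed.
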